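(* Let $q$ be a prime power. If $X$ and $Y$ are $\mathcal{K}(\mathbb{F}_q)$-structures, then $X\cong Y$, i.e. there is a surjective unital isometric $\mathbb{F}_q$-algebra homomorphism $X\to Y$.
   Context: Each matrix algebra $M_n(\mathbb{F}_q)$, $n\ge 1$, carries the metric $d(x,y)=\frac{\mathrm{rank}(x-y)}{n}$. For $m\mid n$, $\iota_{n,m}:M_m(\mathbb{F}_q)\to M_n(\mathbb{F}_q)$ is the isometric unital embedding $x\mapsto x\otimes 1_{n/m}$. A factor sequence is a sequence $n_0,n_1,\dots$ of positive integers with $n_k\mid n_{k+1}$ for all $k$ and $n_k\to\infty$. A $\mathcal{K}(\mathbb{F}_q)$-structure is a metric unital $\mathbb{F}_q$-algebra obtained from some factor sequence $n_0,n_1,\dots$ as the metric completion of the direct limit (with the induced metric) of $M_{n_0}(\mathbb{F}_q)\to M_{n_1}(\mathbb{F}_q)\to\cdots$ along the maps $\iota_{n_{k+1},n_k}$. Isomorphism means isomorphism of metric unital $\mathbb{F}_q$-algebras. *)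

(* Defs.v *)
From HB Require Import structures.
From mathcomp Require Import all_boot all_order all_algebra.
From mathcomp Require Import mxtens.
From mathcomp Require Import boolp classical_sets reals topology.

Set Implicit Arguments.
Unset Strict Implicit.
Unset Printing Implicit Defensive.

Import Order.TTheory GRing.Theory Num.Theory.

Local Open Scope classical_set_scope.
Local Open Scope ring_scope.

(* Continuity of opposite and scaling follows from that of the product, since
   - x = (- 1) * x and a *: x = a%:A * x. *)
HB.mixin Record isMetricAlgebra (R : realType) (F : fieldType) M
    & Metric R M & GRing.Algebra F M := {
  add_cont : continuous (fun z : M * M => z.1 + z.2);
  mul_cont : continuous (fun z : M * M => z.1 * z.2)
}.

#[short(type="metricAlgType")]
HB.structure Definition MetricAlgebra (R : realType) (F : fieldType) :=
  {M of Metric R M & GRing.Algebra F M & isMetricAlgebra R F M}.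

Definition isometric (R : realType) (X Y : metricType R) (f : X -> Y) : Prop :=
  forall x y, mdist (f x) (f y) = mdist x y.

(* The library's [completeType] asks the same of pointed uniform spaces. *)
Definition complete_space (X : uniformType) : Prop :=
  forall G : set_system X, ProperFilter G -> cauchy G -> exists l : X, G --> l.

Definition is_completion (R : realType) (F : fieldType)
    (L X : metricAlgType R F) (j : {lrmorphism L -> X}) : Prop :=
  [/\ isometric j, dense (range j) & complete_space X].

Definition rank_dist (R : realType) (F : fieldType) n (x y : 'M[F]_n) : R :=
  (\rank (x - y))%:R / n%:R.

Lemma tens_dim m n : (m %| n)%N -> (m * (n %/ m) = n)%N.
Proof. by move=> mn; rewrite mulnC divnK. Qed.

Definition iota_mx (F : fieldType) m n (mn : (m %| n)%N) (x : 'M[F]_m) : 'M[F]_n :=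
  castmx (tens_dim mn, tens_dim mn) (tensmx x (1%:M : 'M[F]_(n %/ m))).

Record factor_seq := FactorSeq {
  fseq :> nat -> nat;
  fseq_gt0 : forall k, (0 < fseq k)%N;
  fseq_dvd : forall k, (fseq k %| fseq k.+1)%N;
  fseq_cvg : fseq @ \oo --> \oo
}.

Section DirectLimit.
Variables (F : fieldType) (n : factor_seq).

(* 'M[F]_(n k) is not an instance of [algType], because n k is not
   syntactically a successor; hence unital F-algebra homomorphisms out of it
   are scalable ring morphisms rather than [lrmorphism]s. *)
Definition is_cocone (A : algType F)
    (phi : forall k, {rmorphism 'M[F]_(n k) -> A}) : Prop :=
  (forall k, scalable (phi k)) /\
  (forall k x, phi k.+1 (iota_mx (fseq_dvd n k) x) = phi k x).

Definition is_direct_limit (L : algType F)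
    (phi : forall k, {rmorphism 'M[F]_(n k) -> L}) : Prop :=
  is_cocone phi /\
  forall (A : algType F) (psi : forall k, {rmorphism 'M[F]_(n k) -> A}),
    is_cocone psi ->
    exists h : {lrmorphism L -> A},
      (forall k x, h (phi k x) = psi k x) /\
      (forall h' : {lrmorphism L -> A},
         (forall k x, h' (phi k x) = psi k x) -> h' =1 h).

End DirectLimit.

(* The metric on the direct limit L is the induced one: each canonical map
   'M[F]_(n k) -> L is isometric for the rank metric. *)
Definition K_structure (R : realType) (F : fieldType)
    (X : metricAlgType R F) : Prop :=
  exists (n : factor_seq) (L : metricAlgType R F)
    (phi : forall k, {rmorphism 'M[F]_(n k) -> L}) (j : {lrmorphism L -> X}),
    [/\ is_direct_limit phi,
        forall k x y, mdist (phi k x) (phi k y) = rank_dist R x y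
      & is_completion j].

(* Main.v *)
(* Both algebras are completed unions of chains of matrix algebras, and they are
   compared by approximate intertwining.  For any sizes n <= m, placing m %/ n
   diagonal copies of a matrix of size n inside a matrix of size m, with zeros
   elsewhere, is a contractive non-unital homomorphism whose defect
   1 - (m %/ n) n / m is small when m is large.  Given such a homomorphism f
   from a stage of the first chain to a stage of the second one, there is g of the
   same kind from the latter to a later stage of the first chain, such that g f
   agrees with the inclusion on all but a small proportion of the diagonal
   copies: since all these maps permute basis vectors, constructing g amounts to
   extending a partial injection between finite sets.  Iterating back and forth
   yields almost isometric homomorphisms between the stages whose graphs
   converge to the graph of an isomorphism. *)

Require Import Defs.
From HB Require Import structures.
From mathcomp Require Import all_boot all_order all_algebra.
From mathcomp Require Import mxtens lra.
From mathcomp Require Import reals topology.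

Set Implicit Arguments.
Unset Strict Implicit.
Unset Printing Implicit Defensive.

Import Order.TTheory GRing.Theory Num.Theory.

Local Open Scope ring_scope.

(** * Block-diagonal homomorphisms *)

Lemma injective_card_le (A B : finType) :
  (#|A| <= #|B|)%N -> exists h : A -> B, injective h.
Proof.
move=> AB; exists (fun x => enum_val (widen_ord AB (enum_rank x))) => x y.
by move=> /enum_val_inj /(congr1 val) /= /val_inj /enum_rank_inj.
Qed.

(** The images of [e] and [h] have equal size, so the complement of the first is no larger than that
    of the second, and the complements can be matched by enumeration. *)
Lemma extend_injective (D A B : finType) (e : D -> A) (h : D -> B) :
  injective e -> injective h -> (#|A| <= #|B|)%N ->
  exists h' : A -> B, injective h' /\ forall d, h' (e d) = h d.
Proof.
move=> einj hinj AB.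
pose E := ~: (e @: setT); pose H := ~: (h @: setT).
have EH : (#|E| <= #|H|)%N.
  by rewrite cardsCs [leqRHS]cardsCs !setCK !card_imset // leq_sub2r.
(* The empty case is split off because [nth] needs a default [b0] in [B]; by [kin] that default is
   never returned on [E]. *)
have [a0 _|A0] := pickP (mem A); last first.
  exists (fun a => False_rect B (notF (esym (A0 a)))); split=> [a|d].
    by have := A0 a.
  by have := A0 (e d).
have /card_gt0P[b0 _] : (0 < #|B|)%N.
  by apply: leq_trans AB; apply/card_gt0P; exists a0.
pose k a := nth b0 (enum H) (index a (enum E)).
pose h' a := if [pick d | e d == a] is Some d then h d else k a.
have kin a : a \in E -> (index a (enum E) < size (enum H))%N.
  by move=> aE; rewrite -cardE (leq_trans _ EH) // cardE index_mem mem_enum.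
have h'E a : (exists2 d, a = e d & h' a = h d) \/ (a \in E /\ h' a = k a).
  rewrite /h'; case: pickP => [d /eqP <-|N]; [by left; exists d | right; split=> //].
  by rewrite !inE; apply/imsetP => -[d _ ad]; have := N d; rewrite ad eqxx.
have kH a : a \in E -> k a \in H.
  by move=> aE; rewrite /k -mem_enum mem_nth //; exact: kin.
have hH d : h d \notin H by rewrite !inE negbK imset_f.
exists h'; split=> [x y|d]; last first.
  case: (h'E (e d)) => [[d' /einj -> //]|[]].
  by rewrite !inE imset_f.
case: (h'E x) => [[d -> ->]|[xE ->]]; case: (h'E y) => [[d' -> ->]|[yE ->]].
- by move=> /hinj ->.
- by move=> E1; have := kH _ yE; rewrite -E1 (negbTE (hH d)).
- by move=> E1; have := kH _ xE; rewrite E1 (negbTE (hH d')).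
move=> /eqP; rewrite nth_uniq ?enum_uniq //; try exact: kin.
move=> /eqP eqi; rewrite -(nth_index x (s := enum E) (x := x)) ?mem_enum //.
by rewrite eqi nth_index ?mem_enum.
Qed.

Section Blowup.
Variable F : fieldType.

Definition funmx m n (h : 'I_n -> 'I_m) : 'M[F]_(m, n) :=
  \matrix_(p, i) (p == h i)%:R.

Lemma funmx_mul m n p (g : 'I_n -> 'I_m) (h : 'I_p -> 'I_n) :
  funmx g *m funmx h = funmx (g \o h).
Proof.
apply/matrixP => i k; rewrite !mxE (bigD1 (h k)) //= big1 => [|j /negPf jk].
  by rewrite !mxE eqxx mulr1 addr0.
by rewrite !mxE jk mulr0.
Qed.

Lemma tr_funmx_mul m n p (g : 'I_n -> 'I_m) (h : 'I_p -> 'I_m) :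
  (funmx g)^T *m funmx h = \matrix_(i, j) (g i == h j)%:R.
Proof.
apply/matrixP => i k; rewrite !mxE (bigD1 (h k)) //= big1 => [|j /negPf jk].
  by rewrite !mxE eqxx mulr1 addr0 eq_sym.
by rewrite !mxE jk mulr0.
Qed.

(* Up to the reordering of the basis given by [s], this is the block-diagonal
   matrix with [#|T|] blocks [x], padded with zeros; for [s] injective it is
   multiplicative in [x], but unital only when [s] is onto. *)
Definition blowup (T : finType) m n (s : T * 'I_n -> 'I_m) (x : 'M[F]_n) :
    'M[F]_m :=
  \sum_t funmx (fun i => s (t, i)) *m x *m (funmx (fun i => s (t, i)))^T.

Section Theory.
Variables (T : finType) (m n : nat) (s : T * 'I_n -> 'I_m).

Lemma blowupD x y : blowup s (x + y) = blowup s x + blowup s y.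
Proof.
by rewrite -big_split; apply: eq_bigr => t _; rewrite mulmxDr mulmxDl.
Qed.

Lemma blowupB x y : blowup s (x - y) = blowup s x - blowup s y.
Proof.
rewrite -sumrB; apply: eq_bigr => t _.
by rewrite mulmxBr mulmxBl.
Qed.

Lemma blowupZ a x : blowup s (a *: x) = a *: blowup s x.
Proof.
rewrite scaler_sumr; apply: eq_bigr => t _.
by rewrite -scalemxAr -scalemxAl.
Qed.

(** Injectivity makes the blocks orthogonal: a transposed [funmx] times another is the identity
    within one block and zero between distinct blocks. *)
Lemma blowupM x y : injective s -> blowup s (x *m y) = blowup s x *m blowup s y.
Proof.
move=> sinj; rewrite mulmx_suml; apply: eq_bigr => t _.
rewrite mulmx_sumr (bigD1 t) //= big1 ?addr0 => [|u ut].
  rewrite !mulmxA -[_ *m _^T *m funmx _]mulmxA tr_funmx_mul.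
  suff -> : \matrix_(i, j) (s (t, i) == s (t, j))%:R = 1%:M :> 'M[F]_n.
    by rewrite mulmx1.
  by apply/matrixP => i j; rewrite !mxE (inj_eq sinj) xpair_eqE eqxx.
rewrite !mulmxA -[_ *m _^T *m funmx _]mulmxA tr_funmx_mul.
suff -> : \matrix_(i, j) (s (t, i) == s (u, j))%:R = 0 :> 'M[F]_n.
  by rewrite mulmx0 !mul0mx.
by apply/matrixP => i j; rewrite !mxE (inj_eq sinj) xpair_eqE eq_sym (negPf ut).
Qed.

Lemma mxrank_blowup_sub (P : pred T) x :
  (\rank (\sum_(t | P t) funmx (fun i => s (t, i)) *m x *m
     (funmx (fun i => s (t, i)))^T)%R <= #|P| * \rank x)%N.
Proof.
rewrite -sum_nat_const.
apply: (big_ind2 (fun (A : 'M[F]_m) r => (\rank A <= r)%N)).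
- by rewrite mxrank0.
- move=> A r B q Ar Bq; apply: leq_trans (mxrank_add _ _) _.
  exact: leq_add.
move=> t _; apply: leq_trans (mxrankM_maxl _ _) _.
exact: mxrankM_maxr.
Qed.

Lemma mxrank_blowup x : (\rank (blowup s x) <= #|T| * \rank x)%N.
Proof. exact: (mxrank_blowup_sub xpredT). Qed.

Lemma blowup_card : injective s -> (#|T| * n <= m)%N.
Proof. by move=> /leq_card; rewrite card_prod !card_ord. Qed.

End Theory.

Lemma blowup_comp (S T : finType) m n p (r : S * 'I_m -> 'I_p)
    (s : T * 'I_n -> 'I_m) x :
  blowup r (blowup s x) =
  blowup (fun z : (S * T) * 'I_n => r (z.1.1, s (z.1.2, z.2))) x.
Proof.
rewrite /blowup -(pair_bigA _ (fun u t => funmx (fun i => r (u, s (t, i))) *m x *m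
  (funmx (fun i => r (u, s (t, i))))^T)) /=.
apply: eq_bigr => u _; rewrite mulmx_sumr mulmx_suml; apply: eq_bigr => t _.
by rewrite !mulmxA funmx_mul -[RHS]mulmxA -!mulmxA -trmx_mul funmx_mul mulmxA.
Qed.

(** The reindexed family is a subfamily of the blocks, so the difference consists of the
    [#|T| - #|U|] omitted ones, each of rank at most [n]. *)
Lemma mxrank_blowup_reindex (U T : finType) m n (s : T * 'I_n -> 'I_m)
    (w : U -> T) x : injective w ->
  (\rank (blowup (fun z => s (w z.1, z.2)) x - blowup s x)%R <=
    (#|T| - #|U|) * n)%N.
Proof.
move=> winj; pose P := [set w u | u : U].
have -> : blowup s x = blowup (fun z => s (w z.1, z.2)) x +
    \sum_(t | t \notin P) funmx (fun i => s (t, i)) *m x *m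
      (funmx (fun i => s (t, i)))^T.
  rewrite {1}/blowup (bigID (mem P)) /=; congr (_ + _).
  by rewrite big_imset /= => [|? ? _ _ /winj //]; apply: eq_bigl => u; rewrite inE.
rewrite opprD addNKr mxrank_opp.
apply: leq_trans (mxrank_blowup_sub _ _ _) _.
apply: leq_mul (rank_leq_row _).
have <- : #|P| = #|U| by rewrite card_imset.
rewrite -(cardsC P) addKn.
by rewrite eq_leq //; apply: eq_card => t; rewrite !inE.
Qed.

(** A Kronecker product with an identity is block diagonal once the tensor index is read as
    position, then copy; hence the swap [(z.2, z.1)]. Every index has the form [s (t, i)], so it
    suffices to compare entries there. *)
Lemma iota_mxE m n (mn : (m %| n)%N) (x : 'M[F]_m) :
  iota_mx mn x = blowup (fun z : 'I_(n %/ m) * 'I_m =>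
     cast_ord (tens_dim mn) (mxtens_index (z.2, z.1))) x.
Proof.
set s := fun z => _.
apply/matrixP => p q.
have surj r : exists t i, r = s (t, i).
  case rE: (mxtens_unindex (cast_ord (esym (tens_dim mn)) r)) => [i t].
  by exists t, i; rewrite /s /= -rE mxtens_unindexK cast_ordKV.
have [t0 [i0 ->]] := surj p; have [t1 [i1 ->]] := surj q.
have sinj : injective s.
  by move=> [a b] [c d] /cast_ord_inj /(can_inj (@mxtens_indexK _ _)) [-> ->].
have -> : iota_mx mn x (s (t0, i0)) (s (t1, i1)) = x i0 i1 * (t0 == t1)%:R.
  by rewrite castmxE /s /= !cast_ordK tensmxE mxE.
have entry t : (funmx (fun i => s (t, i)) *m x *m
      (funmx (fun i => s (t, i)))^T) (s (t0, i0)) (s (t1, i1)) =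
    \sum_j \sum_i (((t0, i0) == (t, i))%:R * x i j * ((t1, i1) == (t, j))%:R).
  rewrite mxE; apply: eq_bigr => j _; rewrite mxE mulr_suml.
  by apply: eq_bigr => i _; rewrite !mxE !(inj_eq sinj).
rewrite summxE (bigD1 t0) //= big1 ?addr0 => [|t /negPf tt0]; rewrite entry.
  rewrite (bigD1 i1) //= [X in _ + X]big1 ?addr0 => [|j /negPf ji1].
    rewrite (bigD1 i0) //= [X in _ + X]big1 ?addr0 => [|i /negPf ii0].
      by rewrite !xpair_eqE !eqxx mul1r andbT eq_sym.
    by rewrite xpair_eqE [i0 == _]eq_sym ii0 andbF !mul0r.
  rewrite big1 // => i _.
  by rewrite !xpair_eqE [i1 == _]eq_sym ji1 andbF mulr0.
rewrite big1 // => j _; rewrite big1 // => i _.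
by rewrite xpair_eqE [t0 == _]eq_sym tt0 !mul0r.
Qed.

End Blowup.

From mathcomp Require Import boolp classical_sets.

Local Open Scope classical_set_scope.
Local Open Scope ring_scope.

(** * Towers of matrix algebras *)

Lemma blowup_unit (F : fieldType) n (x : 'M[F]_n) :
  blowup (fun z : unit * 'I_n => z.2) x = x.
Proof.
rewrite /blowup (bigD1 tt) //= big1 => [|[] //].
have -> : funmx F (fun i : 'I_n => i) = 1%:M.
  by apply/matrixP => i j; rewrite !mxE.
by rewrite trmx1 mul1mx mulmx1 addr0.
Qed.

Section Towers.
Variables (R : realType) (F : fieldType).

(** All that is kept of a direct limit and its completion: the composite maps from the stages, with
    dense union. *)
Record is_tower (X : metricAlgType R F) (n : factor_seq)
    (Phi : forall k, 'M[F]_(n k) -> X) : Prop := IsTower {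
  towerD : forall k x y, Phi k (x + y) = Phi k x + Phi k y;
  towerM : forall k x y, Phi k (x *m y) = Phi k x * Phi k y;
  towerZ : forall k a x, Phi k (a *: x) = a *: Phi k x;
  tower_mdist : forall k x y, mdist (Phi k x) (Phi k y) = rank_dist R x y;
  tower_iota : forall k x, Phi k.+1 (iota_mx (fseq_dvd n k) x) = Phi k x;
  tower_dense : forall (x : X) e, 0 < e -> exists k z, mdist x (Phi k z) < e }.

(** The proportion of a basis of size [m] left uncovered by [a] disjoint blocks of size [n]. *)
Definition defect a n m : R := 1 - (a * n)%:R / m%:R.

Lemma fseq_large (n : factor_seq) k0 B :
  exists k, (k0 < k)%N /\ (B <= n k)%N.
Proof.
have /cvgnyPge /(_ B) [k1 _ Hk] := @fseq_cvg n.
exists (maxn k0.+1 k1); split; first by rewrite leq_max leqnn.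
by apply: Hk => /=; rewrite leq_max leqnn orbT.
Qed.

(** The rank grows at most by the factor [#|T|], and disjointness of the blocks gives
    [#|T| * n <= m]. *)
Lemma rank_dist_blowup (T : finType) m n (s : T * 'I_n -> 'I_m) (x y : 'M[F]_n) :
  (0 < n)%N -> (0 < m)%N -> injective s ->
  rank_dist R (blowup s x) (blowup s y) <= rank_dist R x y.
Proof.
move=> n0 m0 sinj; rewrite /rank_dist -blowupB.
rewrite ler_pdivrMr ?ltr0n // mulrAC ler_pdivlMr ?ltr0n // -!natrM ler_nat.
apply: leq_trans (leq_mul (mxrank_blowup s _) (leqnn n)) _.
by rewrite mulnAC mulnC leq_mul2l (blowup_card sinj) orbT.
Qed.

Section Tower.
Variables (X : metricAlgType R F) (n : factor_seq).
Variables (Phi : forall k, 'M[F]_(n k) -> X) (tw : is_tower Phi).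
Arguments Phi : clear implicits.

(** Composites of connecting maps are again block diagonal, with blocks exhausting the larger basis;
    inclusions and approximate maps thus have the same form. *)
Lemma tower_blowup k k' : (k <= k')%N ->
  exists (C : finType) (s : C * 'I_(n k) -> 'I_(n k')),
    [/\ injective s, (#|C| * n k = n k')%N
      & forall x, Phi k' (blowup s x) = Phi k x].
Proof.
elim: k' => [|k' IH]; rewrite leq_eqVlt => /predU1P[<-|] //.
- by exists unit, snd; split=> [[[] i] [[] j] /= -> //||x];
    rewrite ?card_unit ?mul1n ?blowup_unit.
- by exists unit, snd; split=> [[[] i] [[] j] /= -> //||x];
    rewrite ?card_unit ?mul1n ?blowup_unit.
rewrite ltnS => /IH[C [s [sinj cardC Phis]]].
pose s1 (z : 'I_(n k'.+1 %/ n k') * 'I_(n k')) :=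
  cast_ord (tens_dim (fseq_dvd n k')) (mxtens_index (z.2, z.1)).
have s1inj : injective s1.
  by move=> [a b] [c d] /cast_ord_inj /(can_inj (@mxtens_indexK _ _)) [-> ->].
exists ('I_(n k'.+1 %/ n k') * C)%type, (fun z => s1 (z.1.1, s (z.1.2, z.2))).
split=> [[[a b] c] [[a' b'] c'] /= /s1inj [-> /sinj [-> ->]] //||x].
  by rewrite card_prod card_ord -mulnA cardC mulnC tens_dim ?fseq_dvd.
by rewrite -(@blowup_comp F) -iota_mxE (tower_iota tw).
Qed.

(** The return map [r] is chosen so that the blocks of the round trip form a subfamily of the blocks
    of the inclusion into a late stage. The loss is the defect of [s] plus the remainder of dividing
    the late size by [m]. *)
Lemma tower_step (T : finType) k m (s : T * 'I_(n k) -> 'I_m) e :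
  (0 < m)%N -> injective s -> 0 < e ->
  exists k' b (r : 'I_b * 'I_m -> 'I_(n k')),
    [/\ (k < k')%N, injective r, defect b m (n k') <= e
      & forall x, mdist (Phi k' (blowup r (blowup s x))) (Phi k x) <=
          defect #|T| (n k) m + e].
Proof.
move=> m0 sinj e0.
have [k' [kk' Nbig]] := fseq_large n k (Num.bound (m%:R / e)).
have n0 := fseq_gt0 n k; have N0 := fseq_gt0 n k'.
have [C [s0 [s0inj cardC Phis0]]] := tower_blowup (ltnW kk').
set N := n k' in N0 Nbig cardC s0 s0inj Phis0 *.
have N0r : 0 < N%:R :> R by rewrite ltr0n.
have m0r : 0 < m%:R :> R by rewrite ltr0n.
have mNe : m%:R / N%:R <= e.
  rewrite ler_pdivrMr // -ler_pdivrMl // mulrC.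
  apply: le_trans (_ : (Num.bound (m%:R / e))%:R <= _); last by rewrite ler_nat.
  by apply: ltW; apply: archi_boundP; rewrite divr_ge0 ?ler0n // ltW.
pose b := (N %/ m)%N.
have bmN : (b * m <= N)%N by exact: leq_trunc_div.
have Nbm : (N <= b * m + m)%N by rewrite {1}(divn_eq N m) leq_add2l ltnW // ltn_mod.
have Tnm := blowup_card sinj.
have bTC : (b * #|T| * n k <= #|C| * n k)%N.
  by rewrite cardC -mulnA (leq_trans _ bmN) // leq_mul2l Tnm orbT.
(* [w] assigns to each block of the round trip a block of the inclusion. *)
have [w winj] : exists w : 'I_b * T -> C, injective w.
  apply: injective_card_le; rewrite card_prod card_ord.
  by rewrite -(leq_pmul2r n0).
(* [r] is prescribed on the vectors hit by [s] and extended injectively to the others. *)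
have [||| r [rinj rE]] := @extend_injective _ ('I_b * 'I_m)%type 'I_N
    (fun d : ('I_b * T) * 'I_(n k) => (d.1.1, s (d.1.2, d.2)))
    (fun d => s0 (w d.1, d.2)).
- by move=> [[? ?] ?] [[? ?] ?] /= [-> /sinj [-> ->]].
- by move=> [? ?] [? ?] /= /s0inj [/winj -> ->].
- by rewrite card_prod !card_ord.
have Nbm' : N%:R <= b%:R * m%:R + m%:R :> R by rewrite -natrM -natrD ler_nat.
exists k', b, r; split=> //.
  rewrite /defect; apply: le_trans mNe; rewrite lerBlDr -mulrDl ler_pdivlMr // mul1r.
  by rewrite natrM addrC.
move=> x; rewrite -Phis0 tower_mdist // /rank_dist blowup_comp.
have -> : (fun z => r (z.1.1, s (z.1.2, z.2))) = (fun z => s0 (w z.1, z.2)).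
  by apply/funext => z; exact: rE.
apply: (@le_trans _ _ (((#|C| - b * #|T|) * n k)%:R / N%:R)).
  rewrite ler_pM2r ?invr_gt0 // ler_nat.
  by have := mxrank_blowup_reindex s0 x winj; rewrite card_prod card_ord.
pose t : R := (#|T| * n k)%:R.
have t0 : 0 <= t by exact: ler0n.
have tm : t <= m%:R by rewrite ler_nat.
have -> : ((#|C| - b * #|T|) * n k)%:R / N%:R = 1 - b%:R * t / N%:R.
  rewrite mulnBl cardC natrB -?cardC // cardC mulrBl divff ?gt_eqF //.
  by rewrite -mulnA natrM.
(* After clearing denominators: [t * N <= t * (b * m + m)], and [t * m <= m * m]. *)
suff : t / m%:R <= (b%:R * t + m%:R) / N%:R.
  by rewrite /defect -/t mulrDl; move: mNe; lra.
rewrite ler_pdivrMr // mulrAC ler_pdivlMr //.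
have := ler_wpM2l t0 Nbm'; have := ler_wpM2r (ltW m0r) tm.
rewrite mulrDr mulrDl !mulrA [t * b%:R]mulrC; lra.
Qed.

End Tower.
End Towers.

(** * Stages of a direct limit exhaust it *)

Section Subalgebra.
Variables (F : fieldType) (A : algType F) (S : subalgClosed A).

Record subalg := Subalg { subalg_val :> A; _ : subalg_val \in S }.

HB.instance Definition _ := [isSub for subalg_val].
HB.instance Definition _ := [Choice of subalg by <:].
HB.instance Definition _ := [SubChoice_isSubAlgebra of subalg by <:].

Lemma subalg_val_zmod : zmod_morphism subalg_val.
Proof. by move=> x y; exact: (rmorphB (\val : {rmorphism subalg -> A})). Qed.

Lemma subalg_val_monoid : monoid_morphism subalg_val.
Proof.
split=> [|x y]; first exact: (rmorph1 (\val : {rmorphism subalg -> A})).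
exact: (rmorphM (\val : {rmorphism subalg -> A})).
Qed.

Lemma subalg_val_scalable : scalable subalg_val.
Proof. by move=> a x; exact: (linearZ_LR (\val : {linear subalg -> A})). Qed.

HB.instance Definition _ :=
  GRing.isZmodMorphism.Build subalg A subalg_val subalg_val_zmod.
HB.instance Definition _ :=
  GRing.isMonoidMorphism.Build subalg A subalg_val subalg_val_monoid.
HB.instance Definition _ :=
  GRing.isScalable.Build F subalg A *:%R subalg_val subalg_val_scalable.
End Subalgebra.

Section DirectLimitSurjective.
Variables (F : fieldType) (n : factor_seq) (L : algType F).
Variable phi : forall k, {rmorphism 'M[F]_(n k) -> L}.

Definition union_range : {pred L} := fun y => `[< exists k x, phi k x = y >].

Hypothesis phi_cocone : is_cocone phi.

Lemma cocone_le k k' x : (k <= k')%N -> exists x', phi k' x' = phi k x.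
Proof.
elim: k' => [|k' IH]; first by rewrite leqn0 => /eqP <-; exists x.
rewrite leq_eqVlt => /predU1P[<-|]; first by exists x.
rewrite ltnS => /IH[x' <-]; exists (iota_mx (fseq_dvd n k') x').
by have [_ ->] := phi_cocone.
Qed.

Lemma union_range2 y z : y \in union_range -> z \in union_range ->
  exists k a b, phi k a = y /\ phi k b = z.
Proof.
move=> /asboolP[k [a <-]] /asboolP[l [b <-]].
have [a' <-] := cocone_le a (leq_maxl k l).
have [b' <-] := cocone_le b (leq_maxr k l).
by exists (maxn k l), a', b'.
Qed.

Lemma union_range_closed : GRing.subsemialg_closed union_range.
Proof.
have zeroP : 0 \in union_range by apply/asboolP; exists 0%N, 0; rewrite rmorph0.
have oneP : 1 \in union_range by apply/asboolP; exists 0%N, 1; rewrite rmorph1.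
have addP : {in union_range &, forall y z, y + z \in union_range}.
  move=> y z /union_range2/[apply] -[k [a [b [<- <-]]]].
  by apply/asboolP; exists k, (a + b); rewrite rmorphD.
have mulP : {in union_range &, forall y z, y * z \in union_range}.
  move=> y z /union_range2/[apply] -[k [a [b [<- <-]]]].
  by apply/asboolP; exists k, (a * b); rewrite rmorphM.
have scaleP a : {in union_range, forall y, a *: y \in union_range}.
  move=> _ /asboolP[k [x <-]]; apply/asboolP; exists k, (a *: x).
  by have [-> _] := phi_cocone.
by split=> //; split.
Qed.

End DirectLimitSurjective.

(** The union of the images is a subalgebra [S], and the canonical maps corestrict to a cocone on
    it. The induced map from [L] to [S], followed by the inclusion, is the identity by
    uniqueness. *)
Lemma direct_limit_surj (F : fieldType) (n : factor_seq) (L : algType F)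
    (phi : forall k, {rmorphism 'M[F]_(n k) -> L}) :
  is_direct_limit phi -> forall y, exists k x, phi k x = y.
Proof.
move=> [cocone univ] y.
pose S : subalgClosed L := HB.pack (union_range phi)
  (GRing.isSubalgClosed.Build F L _ (union_range_closed cocone)).
have phiS k x : phi k x \in S by apply/asboolP; exists k, x.
pose psi_fun k x : subalg S := Subalg (phiS k x).
have psiB k : zmod_morphism (psi_fun k).
  by move=> a b; apply: val_inj; rewrite /= rmorphB.
have psiM k : monoid_morphism (psi_fun k).
  by split=> [|a b]; apply: val_inj; rewrite /= ?rmorph1 ?rmorphM.
pose psi k : {rmorphism 'M[F]_(n k) -> subalg S} := HB.pack (psi_fun k)
  (GRing.isZmodMorphism.Build _ _ _ (psiB k))
  (GRing.isMonoidMorphism.Build _ _ _ (psiM k)).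
have psi_cocone : is_cocone psi.
  split=> [k a x|k x]; apply: val_inj => /=.
    by rewrite (proj1 cocone).
  exact: (proj2 cocone).
have [h [hE _]] := univ _ _ psi_cocone.
have [h0 [_ uniq]] := univ _ _ cocone.
pose v : {lrmorphism subalg S -> L} := @subalg_val F L S.
have /(_ y) E1 := uniq (v \o h) (fun k x => congr1 val (hE k x)).
have /(_ y) E2 := uniq idfun (fun k x => erefl).
have : \val (h y) \in S := valP (h y).
by rewrite [\val _](etrans E1 (esym E2)) => /asboolP.
Qed.

Lemma K_structure_tower (R : realType) (F : fieldType) (X : metricAlgType R F) :
  K_structure X -> complete_space X /\
  exists (n : factor_seq) (Phi : forall k, 'M[F]_(n k) -> X), is_tower Phi.
Proof.
move=> [n [L [phi [j [lim phi_dist [j_iso j_dense X_cplt]]]]]]; split=> //.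
exists n, (fun k x => j (phi k x)); split.
- by move=> k x y; rewrite !rmorphD.
- by move=> k x y; rewrite -[x *m y]/(x * y) !rmorphM.
- by move=> k a x; rewrite (proj1 (proj1 lim)) linearZ.
- by move=> k x y; rewrite j_iso phi_dist.
- by move=> k x; rewrite (proj2 (proj1 lim)).
move=> x e e0.
have [|y [xy [z _ zy]]] := j_dense (ball x e)^° _ (@open_interior _ _).
  by exists x; exact: nbhsx_ballx.
have [k [w wz]] := direct_limit_surj lim z.
exists k, w; rewrite wz zy.
by have := interior_subset xy; rewrite ballEmdist.
Qed.

(** * Limits of almost isometric graphs *)

Section GraphLimit.
Variable R : realType.

(* The lower limit of the graphs [G i] in [X * Y]. *)
Definition graph_lim (X Y : metricType R) (G : nat -> X -> Y -> Prop) x y :=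
  forall e, 0 < e -> exists N, forall i, (N <= i)%N ->
    exists x' y', [/\ G i x' y', mdist x x' < e & mdist y y' < e].

(** Relations are used instead of maps so that the roles of [X] and [Y] can be exchanged; density is
    asked of the first coordinate only. *)
Record almost_isometries (X Y : metricType R) (eta : nat -> R)
    (G : nat -> X -> Y -> Prop) : Prop := AlmostIsometries {
  graph_err : forall e, 0 < e -> exists N, forall i, (N <= i)%N -> eta i < e;
  graph_mdist : forall i x y x' y', G i x y -> G i x' y' ->
    `|mdist x x' - mdist y y'| <= eta i;
  graph_next : forall i j x y, (i <= j)%N -> G i x y ->
    exists x' y', [/\ G j x' y', mdist x x' <= eta i & mdist y y' <= eta i];
  graph_dense : forall x e N, 0 < e -> exists i x' y',
    [/\ (N <= i)%N, G i x' y' & mdist x x' < e] }.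

Lemma graph_lim_sym (X Y : metricType R) (G : nat -> X -> Y -> Prop) x y :
  graph_lim G x y -> graph_lim (fun i y x => G i x y) y x.
Proof.
move=> Gxy e /Gxy[N GN]; exists N => i /GN[x' [y' [? ? ?]]].
by exists y', x'.
Qed.

Lemma graph_lim_mdist (X Y : metricType R) eta (G : nat -> X -> Y -> Prop) :
  almost_isometries eta G ->
  forall x y x' y', graph_lim G x y -> graph_lim G x' y' ->
  mdist x x' = mdist y y'.
Proof.
move=> GA x y x' y' Gxy Gxy'; apply/eqP; rewrite -subr_eq0 -normr_eq0.
apply/eqP/le_anti; rewrite normr_ge0 andbT; apply/ler_addgt0Pl => e e0.
(* Five errors add up: two endpoints in [X], two in [Y], and [eta i]. *)
have e5 : 0 < e / 5 by rewrite divr_gt0.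
have [N1 G1] := Gxy _ e5; have [N2 G2] := Gxy' _ e5.
have [N3 G3] := graph_err GA e5.
pose i := maxn N1 (maxn N2 N3).
have [|a [b [Gab xa yb]]] := G1 i; first by rewrite leq_maxl.
have [|a' [b' [Gab' xa' yb']]] := G2 i; first by rewrite !leq_max leqnn orbT.
have := G3 i; rewrite !leq_max leqnn !orbT => /(_ isT) ei.
have := graph_mdist GA Gab Gab'.
have := metric_triangle x a x'; have := metric_triangle a a' x'.
have := metric_triangle a x a'; have := metric_triangle x x' a'.
have := metric_triangle y b y'; have := metric_triangle b b' y'.
have := metric_triangle b y b'; have := metric_triangle y y' b'.
rewrite (metric_sym a x) (metric_sym a' x') (metric_sym b y) (metric_sym b' y').
rewrite addr0 !ler_norml => *; apply/andP; lra.
Qed.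

(** The second coordinates of late graph points lying over points close to [x] form a Cauchy filter
    base; its limit is the required [y]. *)
Lemma graph_lim_total (X Y : metricType R) eta (G : nat -> X -> Y -> Prop) :
  almost_isometries eta G -> complete_space Y ->
  forall x, exists y, graph_lim G x y.
Proof.
move=> GA Ycplt x.
pose B (p : R * nat) : set Y := [set y' | exists i x',
  [/\ (p.2 <= i)%N, G i x' y' & mdist x x' < p.1]].
pose D : set (R * nat) := [set p | 0 < p.1].
have B_filter : Filter (filter_from D B).
  apply: filter_from_filter; first by exists (1, 0%N); exact: ltr01.
  move=> [e N] [e' N'] /= e0 e'0; exists (Num.min e e', maxn N N').
    by rewrite /D /= lt_min e0.
  move=> y' [i [x' /= []]]; rewrite geq_max lt_min => /andP[? ?] ? /andP[? ?].
  by split; exists i, x'.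
have B_proper : ProperFilter (filter_from D B).
  apply: filter_from_proper => -[e N] /= e0.
  by have [i [x' [y' ?]]] := graph_dense GA x N e0; exists y', i, x'.
(* The point of [G i] is moved to [G j], costing [eta i] in each coordinate; [x'] and [x''] are less
   than [2 * e] apart, and comparison inside [G j] costs [eta j]. *)
have B_close e : 0 < e -> exists N, forall i x' y' j x'' y'',
    (N <= i <= j)%N -> G i x' y' -> G j x'' y'' ->
    mdist x x' < e -> mdist x x'' < e -> mdist y' y'' < 5 * e.
  move=> e0; have [N etaN] := graph_err GA e0.
  exists N => i x' y' j x'' y'' /andP[Ni ij] Gi Gj xx' xx''.
  have [u [v [Guv xu yv]]] := graph_next GA ij Gi.
  have := graph_mdist GA Guv Gj; rewrite ler_norml => /andP[+ _].
  have := etaN _ Ni; have := etaN _ (leq_trans Ni ij).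
  have := metric_triangle y' v y''; have := metric_triangle u x' x''.
  have := metric_triangle x' x x''.
  rewrite (metric_sym u x') (metric_sym x' x); lra.
have [|y By] := Ycplt (filter_from D B) B_proper.
  apply/cauchy_ballP => e e0; have e5 : 0 < e / 5 by rewrite divr_gt0.
  have [N HN] := B_close _ e5.
  exists (B (e / 5, N), B (e / 5, N)); first by split; exists (e / 5, N).
  move=> [y' y''] /= [[i [x' /= [Ni Gi xx']]] [j [x'' /= [Nj Gj xx'']]]].
  rewrite ballEmdist /=.
  have e5E : 5 * (e / 5) = e by lra.
  have [ij|/ltnW ji] := leqP i j.
    by rewrite -e5E (HN i x' y' j x'' y'') // Ni.
  by rewrite -e5E metric_sym (HN j x'' y'' i x' y') // Nj.
exists y => e e0; have e2 : 0 < e / 2 by rewrite divr_gt0.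
have [N etaN] := graph_err GA e2.
have yball : nbhs y (ball y (e / 2)) by exact: nbhsx_ballx.
have [[d M] /= d0 BM] := By _ yball.
have e2d : 0 < Num.min (e / 2) d by rewrite lt_min e2.
have [i [x' [y' []]]] := graph_dense GA x (maxn N M) e2d.
rewrite geq_max lt_min => /andP[Ni Mi] Gi /andP[xe xd].
have yy' : mdist y y' < e / 2.
  by have := BM y'; rewrite ballEmdist; apply; exists i, x'.
(* One good point at stage [i] serves all later stages, since moving it costs less than [e / 2]. *)
exists i => j ij; have [u [v [Guv xu yv]]] := graph_next GA ij Gi.
exists u, v; have := etaN _ Ni => ei; split=> //.
  have := metric_triangle x x' u; lra.
have := metric_triangle y y' v; lra.
Qed.

End GraphLimit.

(** * Algebra homomorphisms from limit graphs *)

Section GraphMorphism.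
Variables (R : realType) (F : fieldType).

Lemma continuous2_mdist (X : metricType R) (op : X * X -> X) x y e :
  continuous op -> 0 < e -> exists2 d, 0 < d &
  forall x' y', mdist x x' < d -> mdist y y' < d ->
    mdist (op (x, y)) (op (x', y')) < e.
Proof.
move=> op_cont e0.
have /(_ _ (nbhsx_ballx (op (x, y)) e e0)) := op_cont (x, y).
rewrite /nbhs /= => -[[A B] /= [/nbhs_ballP[d /= d0 dA]]].
move=> /nbhs_ballP[d' /= d'0 dB] AB.
exists (Num.min d d'); first by rewrite lt_min d0.
move=> x' y'; rewrite !lt_min => /andP[xd _] /andP[_ yd].
have := AB (x', y'); rewrite /= ballEmdist; apply; split=> /=.
  by apply: dA; rewrite ballEmdist.
by apply: dB; rewrite ballEmdist.
Qed.

Lemma graph_lim_op2 (X Y : metricType R) (opX : X * X -> X) (opY : Y * Y -> Y)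
    (G : nat -> X -> Y -> Prop) :
  continuous opX -> continuous opY ->
  (forall i x y x' y', G i x y -> G i x' y' -> G i (opX (x, x')) (opY (y, y'))) ->
  forall x y x' y', graph_lim G x y -> graph_lim G x' y' ->
  graph_lim G (opX (x, x')) (opY (y, y')).
Proof.
move=> cX cY Gop x y x' y' Gxy Gxy' e e0.
have [d d0 dP] := continuous2_mdist x x' cX e0.
have [d' d'0 d'P] := continuous2_mdist y y' cY e0.
have dd0 : 0 < Num.min d d' by rewrite lt_min d0.
have [N GN] := Gxy _ dd0; have [N' GN'] := Gxy' _ dd0.
exists (maxn N N') => i; rewrite geq_max => /andP[/GN + /GN'].
move=> [a [b [Gab]]]; rewrite !lt_min => /andP[xa _] /andP[_ yb].
move=> [a' [b' [Gab']]]; rewrite !lt_min => /andP[xa' _] /andP[_ yb'].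
by exists (opX (a, a')), (opY (b, b')); split; [exact: Gop|exact: dP|exact: d'P].
Qed.

Lemma scale_mdist (X : metricAlgType R F) a (x : X) e :
  0 < e -> exists2 d, 0 < d &
  forall x', mdist x x' < d -> mdist (a *: x) (a *: x') < e.
Proof.
move=> e0; have [d d0 dP] := continuous2_mdist (a *: 1) x (@mul_cont R F X) e0.
exists d => // x' xd; have := dP (a *: 1) x'; rewrite /= -!scalerAl !mul1r.
by apply=> //; rewrite mdistxx.
Qed.

Lemma graph_lim_scale (X Y : metricAlgType R F) (G : nat -> X -> Y -> Prop) a :
  (forall i x y, G i x y -> G i (a *: x) (a *: y)) ->
  forall x y, graph_lim G x y -> graph_lim G (a *: x) (a *: y).
Proof.
move=> GZ x y Gxy e e0.
have [d d0 dP] := scale_mdist a x e0; have [d' d'0 d'P] := scale_mdist a y e0.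
have dd0 : 0 < Num.min d d' by rewrite lt_min d0.
have [N GN] := Gxy _ dd0; exists N => i /GN.
move=> [x' [y' [Gxy']]]; rewrite !lt_min => /andP[xd _] /andP[_ yd].
by exists (a *: x'), (a *: y'); split; [exact: GZ|exact: dP|exact: d'P].
Qed.

(** The limit graph is total and preserves distances, hence is single-valued; totality of the
    reversed graph gives surjectivity. *)
Lemma graph_lim_iso (X Y : metricAlgType R F) eta (G : nat -> X -> Y -> Prop) :
  complete_space X -> complete_space Y ->
  almost_isometries eta G -> almost_isometries eta (fun i y x => G i x y) ->
  (forall i x y x' y', G i x y -> G i x' y' -> G i (x + x') (y + y')) ->
  (forall i x y x' y', G i x y -> G i x' y' -> G i (x * x') (y * y')) ->
  (forall i a x y, G i x y -> G i (a *: x) (a *: y)) ->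
  exists f : {lrmorphism X -> Y}, isometric f /\ forall y, exists x, f x = y.
Proof.
move=> Xcplt Ycplt GA GA' GD GM GZ.
have [f fP] := choice (graph_lim_total GA Ycplt).
have fE x y : graph_lim G x y -> f x = y.
  move=> Gxy; apply: mdist_positivity.
  by rewrite -(graph_lim_mdist GA (fP x) Gxy) mdistxx.
have f_surj y : exists x, f x = y.
  have [x Gyx] := graph_lim_total GA' Xcplt y.
  by exists x; apply: fE; exact: graph_lim_sym Gyx.
have fD x y : f (x + y) = f x + f y.
  exact/fE/(graph_lim_op2 (@add_cont R F X) (@add_cont R F Y) (@GD) (fP x) (fP y)).
have fM x y : f (x * y) = f x * f y.
  exact/fE/(graph_lim_op2 (@mul_cont R F X) (@mul_cont R F Y) (@GM) (fP x) (fP y)).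
have fZ : scalable f by move=> a x; exact/fE/(graph_lim_scale (GZ ^~ a) (fP x)).
have fB : zmod_morphism f.
  by move=> x y; rewrite fD -scaleN1r fZ scaleN1r.
(* [f 1] is a unit for the image of [f], which is all of [Y]. *)
have f1 : f 1 = 1.
  by have [x fx] := f_surj 1; rewrite -[f 1]mulr1 -fx -fM mul1r.
pose g : {lrmorphism X -> Y} := HB.pack f
  (GRing.isZmodMorphism.Build _ _ _ fB)
  (GRing.isMonoidMorphism.Build _ _ _ (conj f1 fM))
  (GRing.isScalable.Build _ _ _ _ _ fZ).
exists g; split=> [x y|]; last exact: f_surj.
by rewrite (graph_lim_mdist GA (fP x) (fP y)).
Qed.

End GraphMorphism.

(** * Approximate intertwining *)

Section Intertwining.
Variables (R : realType) (F : fieldType) (X Y : metricAlgType R F).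
Variables (n m : factor_seq).
Variable Phi : forall k, 'M[F]_(n k) -> X.
Variable Psi : forall l, 'M[F]_(m l) -> Y.
Arguments Phi : clear implicits.
Arguments Psi : clear implicits.
Hypotheses (twX : is_tower Phi) (twY : is_tower Psi).

Record stage := Stage {
  dom : nat; cod : nat; mult : nat;
  emb : 'I_mult * 'I_(n dom) -> 'I_(m cod) }.

Definition err i : R := 2^-1 ^+ i.

Definition good i (S : stage) :=
  injective (@emb S) /\ defect R (mult S) (n (dom S)) (m (cod S)) <= err i.

Definition graph (S : stage) (x : X) (y : Y) :=
  exists z, x = Phi (dom S) z /\ y = Psi (cod S) (blowup (@emb S) z).

(** The three estimates say that [S] nearly preserves distances, that successive graphs are
    compatible, and that [S'] nearly reaches all of the target of [S]. *)
Record next i (S S' : stage) : Prop := Next {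
  next_dom : (dom S < dom S')%N;
  next_cod : (cod S < cod S')%N;
  next_mdist : forall x y x' y', graph S x y -> graph S x' y' ->
    mdist x x' <= mdist y y' + 4 * err i;
  next_graph : forall x y, graph S x y ->
    exists y', graph S' x y' /\ mdist y y' <= 4 * err i;
  next_surj : forall z, exists x' y',
    graph S' x' y' /\ mdist (Psi (cod S) z) y' <= 4 * err i }.

Lemma err_gt0 i : 0 < err i.
Proof. by rewrite exprn_gt0 // invr_gt0. Qed.

Lemma errS i : err i = 2 * err i.+1.
Proof. by rewrite /err exprS; lra. Qed.

Lemma err_small e : 0 < e -> exists N, forall i, (N <= i)%N -> 8 * err i < e.
Proof.
move=> e0; exists (Num.bound (8 / e)) => i Ni.
have i2 : i%:R < 2 ^+ i :> R by rewrite -natrX ltr_nat ltn_expl.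
have : 8 / e < 2 ^+ i.
  apply: le_lt_trans i2; apply: le_trans (_ : (Num.bound (8 / e))%:R <= _).
    by apply/ltW/archi_boundP; rewrite divr_ge0 // ltW.
  by rewrite ler_nat.
rewrite /err exprVn -ltr_pdivlMr ?invr_gt0 ?exprn_gt0 // invrK.
by rewrite ltr_pdivrMr // ?[2 ^+ i * e]mulrC ?exprn_gt0.
Qed.

Lemma blowup_contract S x x' : injective (@emb S) ->
  mdist (Psi (cod S) (blowup (@emb S) x)) (Psi (cod S) (blowup (@emb S) x'))
    <= mdist (Phi (dom S) x) (Phi (dom S) x').
Proof.
move=> inj; rewrite (tower_mdist twX) (tower_mdist twY).
exact: rank_dist_blowup (fseq_gt0 _ _) (fseq_gt0 _ _) inj.
Qed.

(** One step back to the first chain by [r], then one step forward by [s], which becomes the new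
    stage. Both round trips move points by at most [2 * err i]. *)
Lemma good_next i S : good i S -> exists S', good i.+1 S' /\ next i S S'.
Proof.
move=> [inj dS].
have [k' [b [r [kk' rinj db Xclose]]]] :=
  tower_step twX (fseq_gt0 m (cod S)) inj (err_gt0 i.+1).
have [l' [a [s [ll' sinj da Yclose]]]] :=
  tower_step twY (fseq_gt0 n k') rinj (err_gt0 i.+1).
move: dS; rewrite !card_ord in Xclose Yclose * => dS.
have e2 := errS i; have e0 := err_gt0 i.+1.
pose S' := Stage s.
have S'inj : injective (@emb S') by [].
have XcloseS z : mdist (Phi k' (blowup r (blowup (@emb S) z))) (Phi (dom S) z)
    <= 2 * err i by have := Xclose z; lra.
have YcloseS z : mdist (Psi l' (blowup s (blowup r z))) (Psi (cod S) z)
    <= 2 * err i by have := Yclose z; lra.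
have r_contract z z' : mdist (Phi k' (blowup r z)) (Phi k' (blowup r z')) <=
    mdist (Psi (cod S) z) (Psi (cod S) z').
  rewrite (tower_mdist twX) (tower_mdist twY).
  exact: rank_dist_blowup (fseq_gt0 _ _) (fseq_gt0 _ _) rinj.
exists S'; split=> //; split=> //.
(* As [r] is contractive and the round trip nearly fixes both points, [emb S] cannot shrink their
   distance by more than [4 * err i]. *)
- move=> _ _ _ _ [z [-> ->]] [z' [-> ->]].
  set u := blowup (@emb S) z; set u' := blowup (@emb S) z'.
  have := r_contract u u'; have := XcloseS z; have := XcloseS z'.
  rewrite -/u -/u' => ? ? ?.
  have := metric_triangle (Phi (dom S) z) (Phi k' (blowup r u)) (Phi (dom S) z').
  have := metric_triangle (Phi k' (blowup r u)) (Phi k' (blowup r u'))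
    (Phi (dom S) z').
  rewrite (metric_sym (Phi (dom S) z) (Phi k' _)); lra.
- move=> _ _ [z [-> ->]].
  have [C [c [_ _ cE]]] := tower_blowup twX (ltnW kk').
  exists (Psi l' (blowup s (blowup c z))); split.
    by exists (blowup c z); rewrite /= cE.
  set u := blowup (@emb S) z.
  (* Contractivity of [s] carries the closeness of [blowup r u] and [blowup c z] over to [Y], where
     the second round trip brings [u] close to its image. *)
  have := @blowup_contract S' (blowup r u) (blowup c z) S'inj.
  have := XcloseS z; have := YcloseS u.
  have := metric_triangle (Psi (cod S) u) (Psi l' (blowup s (blowup r u)))
    (Psi l' (blowup s (blowup c z))).
  rewrite /= cE (metric_sym (Psi (cod S) u) (Psi l' (blowup s (blowup r u)))); lra.
move=> z; exists (Phi k' (blowup r z)), (Psi l' (blowup s (blowup r z))).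
split; first by exists (blowup r z).
have := YcloseS z; rewrite metric_sym; lra.
Qed.

Lemma stage_sequence :
  exists st : nat -> stage, forall i, good i (st i) /\ next i (st i) (st i.+1).
Proof.
(* Goodness is put under the existential, so that choice yields a successor function on all
   pairs. *)
have stepP (p : nat * stage) : exists S', good p.1 p.2 ->
    good p.1.+1 S' /\ next p.1 p.2 S'.
  have [/good_next[S' ?]|?] := pselect (good p.1 p.2); first by exists S'.
  by exists p.2.
have [f fP] := choice stepP.
(* The initial stage has no blocks: it is the zero homomorphism, of defect [1 = err 0]. *)
have emb0 (z : 'I_0 * 'I_(n 0)) : 'I_(m 0) by case: z => -[].
pose st := fix st i := if i is j.+1 then f (j, st j) else Stage emb0.
have st_good i : good i (st i).
  elim: i => [|i IH]; last by have [] := fP (i, st i) IH.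
  split=> [[[]] //|]; rewrite /defect /= mul0n mul0r subr0 /err expr0; exact: lexx.
by exists st => i; split=> //; have [] := fP (i, st i) (st_good i).
Qed.

Lemma tower_iso : complete_space X -> complete_space Y ->
  exists f : {lrmorphism X -> Y}, isometric f /\ forall y, exists x, f x = y.
Proof.
move=> Xcplt Ycplt; have [st stP] := stage_sequence.
pose G i := graph (st i).
have e0 := err_gt0.
have inj i : injective (@emb (st i)) by have [[]] := stP i.
have nx i : next i (st i) (st i.+1) by have [] := stP i.
have G_contract i x y x' y' : G i x y -> G i x' y' -> mdist y y' <= mdist x x'.
  by move=> [z [-> ->]] [z' [-> ->]]; exact: blowup_contract.
have G_mdist i x y x' y' : G i x y -> G i x' y' ->
    `|mdist x x' - mdist y y'| <= 8 * err i.
  move=> Gxy Gxy'; have := G_contract _ _ _ _ _ Gxy Gxy'.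
  have := next_mdist (nx i) Gxy Gxy'; have := e0 i.
  by rewrite ler_norml => *; apply/andP; lra.
(* 4 * (err i + ... + err (j - 1)) = 8 * err i - 8 * err j *)
have G_next i j x y : (i <= j)%N -> G i x y ->
    exists y', G j x y' /\ mdist y y' <= 8 * err i - 8 * err j.
  elim: j => [|j IH]; rewrite leq_eqVlt => /predU1P[<-|] //.
  - by exists y; rewrite mdistxx subrr.
  - by exists y; rewrite mdistxx subrr.
  rewrite ltnS => /IH/[apply] -[y' [Gy' yy']].
  have [y'' [Gy'' y'y'']] := next_graph (nx j) Gy'.
  exists y''; split=> //; have := metric_triangle y y' y''.
  have := errS j; lra.
have dom_large k : (k <= dom (st k))%N.
  elim: k => // k IH; exact: leq_ltn_trans IH (next_dom (nx k)).
have cod_large k : (k <= cod (st k))%N.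
  elim: k => // k IH; exact: leq_ltn_trans IH (next_cod (nx k)).
have dom_mono k j : (k <= j)%N -> (k <= dom (st j))%N.
  by move=> kj; exact: leq_trans kj (dom_large j).
have cod_mono k j : (k <= j)%N -> (k <= cod (st j))%N.
  by move=> kj; exact: leq_trans kj (cod_large j).
apply: (@graph_lim_iso _ _ _ _ (fun i => 8 * err i) G) => //.
- split=> // [e|i j x y ij /(G_next _ _ _ _ ij) [y' [? yy']]|x e N epos].
  + exact: err_small.
  + exists x, y'; split=> //; rewrite ?mdistxx; have := e0 i; have := e0 j; lra.
  have [k [z xz]] := tower_dense twX x epos.
  pose i := maxn N k.
  have [C [c [_ _ cE]]] := tower_blowup twX (dom_mono k i (leq_maxr _ _)).
  exists i, (Phi _ (blowup c z)), (Psi _ (blowup (@emb (st i)) (blowup c z))).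
  by split; [exact: leq_maxl|exists (blowup c z)|rewrite cE].
- split=> [e|i x y x' y' Gxy Gxy'
    |i j y x ij /(G_next _ _ _ _ ij) [y' [? yy']]|y e N epos].
  + exact: err_small.
  + by rewrite distrC; exact: G_mdist.
  + exists y', x; split=> //; rewrite ?mdistxx; have := e0 i; have := e0 j; lra.
  have e20 : 0 < e / 2 by rewrite divr_gt0.
  have [l [z yz]] := tower_dense twY y e20.
  have [N' errN'] := err_small e20.
  pose i := maxn (maxn N N') l.
  have [C [c [_ _ cE]]] := tower_blowup twY (cod_mono l i (leq_maxr _ _)).
  (* Density in [Y] comes from approximate surjectivity, whose witness lies in the graph of index
     [i.+1]; the two halves of [e] pay for [yz] and [close]. *)
  have [x' [y' [G' close]]] := next_surj (nx i) (blowup c z).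
  exists i.+1, y', x'; split=> //.
    by rewrite ltnW // ltnS /i -maxnA leq_maxl.
  have /errN' : (N' <= i)%N by rewrite /i -maxnA maxnCA leq_maxl.
  move: close; rewrite cE; have := metric_triangle y (Psi l z) y'.
  have := e0 i; lra.
- move=> i _ _ _ _ [z [-> ->]] [z' [-> ->]]; exists (z + z').
  by rewrite blowupD (towerD twX) (towerD twY).
- move=> i _ _ _ _ [z [-> ->]] [z' [-> ->]]; exists (z *m z').
  by rewrite blowupM ?(towerM twX) ?(towerM twY).
move=> i a _ _ [z [-> ->]]; exists (a *: z).
by rewrite blowupZ (towerZ twX) (towerZ twY).
Qed.

End Intertwining.

Theorem theorem4p1 (R : realType) (F : finFieldType) (X Y : metricAlgType R F)
    (hX : K_structure X) (hY : K_structure Y) :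
  exists f : {lrmorphism X -> Y}, isometric f /\ forall y : Y, exists x : X, f x = y.
Proof.
have [Xcplt [n [Phi twX]]] := K_structure_tower hX.
have [Ycplt [m [Psi twY]]] := K_structure_tower hY.
exact: tower_iso twX twY Xcplt Ycplt.
Qed.
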